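(* Let $k\ge 1$, let $\mathcal{L}=\{\mathcal{M}_1,\dots,\mathcal{M}_k\}$ be a system of $k$ loopless matroids on the same finite ground set $V$, and let $w\in\mathbb{R}^V_{\ge 0}$. Then $\bar{\tau}^*_w(\mathcal{L})=\bar{\nu}^*_w(\mathcal{L})$.
   Context: A matroid is identified with the family of its independent sets; loopless means every singleton is independent. For $f\in\mathbb{R}^V$ write $f[V]=\sum_{v\in V}f(v)$. For a matroid $\mathcal{M}$ on $V$, $P(\mathcal{M})\subseteq\mathbb{R}^V_{\ge 0}$ is the convex hull of the characteristic vectors $\mathbf{1}_S$, $S\in\mathcal{M}$, and $\mathrm{span}_{\mathcal{M}}(A)$ denotes the closure of $A\subseteq V$ in $\mathcal{M}$. For $f:V\to\mathbb{R}$, the $\mathcal{M}$-span of $f$ is the function $$f^{\mathcal{M}}(v)=\max_{T\subseteq V:\ v\in \mathrm{span}_{\mathcal{M}}(T)}\ \min_{u\in T}f(u).$$ Let $R(\mathcal{L})=\bigcap_{i=1}^kP(\mathcal{M}_i)$. The matroidal fractional $w$-matching number $\bar{\nu}^*_w(\mathcal{L})$ is the maximum of $x\cdot w=\sum_{v\in V}x(v)w(v)$ over all $x\in R(\mathcal{L})$. A matroidal fractional $w$-cooperative cover is a $k$-tuple $(f_1,\dots,f_k)$ of functions in $\mathbb{R}^V_{\ge 0}$ such that $\sum_{i=1}^kf_i^{\mathcal{M}_i}(v)\ge w(v)$ for every $v\in V$. The matroidal fractional $w$-covering number $\bar{\tau}^*_w(\mathcal{L})$ is the minimum of $\sum_{i=1}^kf_i[V]$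 over all matroidal fractional $w$-cooperative covers. *)

(* Defs.v *)
From mathcomp Require Import all_boot all_order all_algebra.
From mathcomp Require Import boolp classical_sets reals.

Set Implicit Arguments.
Unset Strict Implicit.
Unset Printing Implicit Defensive.

Import Order.TTheory GRing.Theory Num.Theory.
Local Open Scope ring_scope.

Record matroid (V : finType) := Matroid {
  indep : {set {set V}};
  indep0 : finset.set0 \in indep;
  indep_sub : forall S T : {set V}, S \subset T -> T \in indep -> S \in indep;
  indep_aug : forall S T : {set V}, S \in indep -> T \in indep ->
    (#|S| < #|T|)%N -> exists2 x, x \in T :\: S & x |: S \in indep
}.

Section MatroidNotions.
Variable V : finType.
Implicit Types (M : matroid V) (A T : {set V}).

Definition loopless M : Prop := forall v : V, [set v]%SET \in indep M.

Definition rank M A : nat := (\max_(S in indep M | S \subset A) #|S|)%N.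

Definition span M A : {set V} := [set v | rank M (v |: A) == rank M A]%SET.

Variable R : realType.
Implicit Types f x w : V -> R.

Definition nonneg_fun f : Prop := forall v, 0 <= f v.

Definition total f : R := \sum_v f v.

Definition dot x w : R := \sum_v x v * w v.

Definition indicator A : V -> R := fun v => (v \in A)%:R.

(* Convex hull of the characteristic vectors of the independent sets: [a S] is
   the coefficient of [indicator S]. *)
Definition matroid_polytope M : set (V -> R) :=
  [set x | exists a : {set V} -> R,
    [/\ forall S, S \in indep M -> 0 <= a S,
        \sum_(S in indep M) a S = 1 &
        forall v, x v = \sum_(S in indep M) a S * indicator S v]]%classic.

(* The default of the minimum is a value of [f] on [T], so it does not affect
   the result (see [min_onP]); the value 0 for empty [T] is a dummy. *)
Definition min_on f T : R :=
  if [pick u in T] is Some u0 then \big[Num.min/f u0]_(u in T) f u else 0.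

(* The default [f v] is the value at [T = [set v]], which always spans [v]. In a
   loopless matroid only nonempty sets [T] span [v] (see [span_funP]). *)
Definition span_fun M f : V -> R :=
  fun v => \big[Num.max/f v]_(T : {set V} | v \in span M T) min_on f T.

Lemma min_onP f T : T != finset.set0 ->
  (exists2 u, u \in T & min_on f T = f u) /\
  (forall u, u \in T -> min_on f T <= f u).
Proof.
rewrite /min_on => T0; case: pickP => [u0 u0T|T_]; last first.
  by case/set0Pn: T0 => u; rewrite T_.
split; last by move=> u uT; apply: bigmin_le_cond.
apply: (big_ind (fun y => exists2 u, u \in T & y = f u)).
- by exists u0.
- by move=> _ _ [u uT ->] [t tT ->]; rewrite minEle; case: ifP; [exists u|exists t].
- by move=> u uT; exists u.
Qed.

Lemma span_set1 M v : v \in span M [set v]%SET.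
Proof. by rewrite inE finset.setUid. Qed.

Lemma loopless_span0 M : loopless M -> span M finset.set0 = finset.set0.
Proof.
move=> Ml; apply/setP => v; rewrite !inE finset.setU0; apply/negbTE.
rewrite neq_ltn; apply/orP; right; rewrite /rank big1 => [|S /andP[_]]; last first.
  by rewrite finset.subset0 => /eqP ->; rewrite cards0.
by rewrite -(cards1 v); apply: leq_bigmax_cond; rewrite Ml /=.
Qed.

Lemma min_on_set1 f v : min_on f [set v]%SET = f v.
Proof.
have [|[u]] := @min_onP f [set v]%SET; last by rewrite inE => /eqP ->.
by apply/set0Pn; exists v; rewrite inE.
Qed.

Lemma span_funP M f v : loopless M ->
  (exists T, [/\ T != finset.set0, v \in span M T & span_fun M f v = min_on f T]) /\
  (forall T, v \in span M T -> T != finset.set0 /\ min_on f T <= span_fun M f v).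
Proof.
move=> Ml; have ne T : v \in span M T -> T != finset.set0.
  by apply: contraTneq => ->; rewrite loopless_span0 // inE.
split; last by move=> T vT; split; [exact: ne|apply: le_bigmax_cond].
suff [T vT e] : exists2 T, v \in span M T & span_fun M f v = min_on f T.
  by exists T; split=> //; exact: ne.
apply: (big_ind (fun y => exists2 T, v \in span M T & y = min_on f T)).
- by exists [set v]%SET; [exact: span_set1|rewrite min_on_set1].
- by move=> _ _ [A vA ->] [B vB ->]; rewrite maxEle; case: ifP; [exists B|exists A].
- by move=> T vT; exists T.
Qed.

Variable k : nat.
Implicit Types L : 'I_k -> matroid V.

Definition common_polytope L : set (V -> R) :=
  [set x | forall i, matroid_polytope (L i) x]%classic.

Definition cooperative_cover L w (f : 'I_k -> V -> R) : Prop :=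
  (forall i, nonneg_fun (f i)) /\
  (forall v, w v <= \sum_(i < k) span_fun (L i) (f i) v).

Definition matching_values L w : set R :=
  [set dot x w | x in common_polytope L]%classic.

Definition covering_values L w : set R :=
  [set \sum_(i < k) total (f i) | f in cooperative_cover L w]%classic.

Definition matching_number L w : R := sup (matching_values L w).

Definition covering_number L w : R := inf (covering_values L w).

End MatroidNotions.

Definition is_maximum (R : realType) (A : set R) (m : R) : Prop :=
  A m /\ ubound A m.

Definition is_minimum (R : realType) (A : set R) (m : R) : Prop :=
  A m /\ lbound A m.

(* Main.v *)
From Pilot Require Import Defs.
From mathcomp Require Import all_boot all_order all_algebra.
From mathcomp Require Import boolp classical_sets reals.
From mathcomp Require Import zify ring lra.

Set Implicit Arguments.
Unset Strict Implicit.
Unset Printing Implicit Defensive.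

(* [vector] also exports a [span]; this makes [span] the matroid closure. *)
Import Pilot.Defs.
Import Order.TTheory GRing.Theory Num.Theory.
Local Open Scope ring_scope.

(** Both numbers are the optimal values of linear programs that are dual to
each other, up to replacing a dual solution by a cooperative cover.

Weak duality ([weak_duality]): on the polytope of one matroid M, the linear form
given by the M-span of f >= 0 is at most f[V]. It suffices to see this at
the vertices 1_S with S independent, and there S can be matched injectively to
elements of V so that v goes to an element at which f is at least f^M(v): the
part of S where f^M >= c lies in the span of {f >= c}, so it has at most as many
elements as {f >= c} ([sum_span_fun_le]).

Strong duality ([strong_duality]): writing a point x of the common polytope as a
convex combination of independent sets once for each matroid turns the matching
problem into a linear program. A dual optimal solution consists of weights
g_i on V and numbers t_i such that sum_i g_i >= w and g_i(S) <= t_i for every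
S independent in M_i; the optimal value is sum_i t_i. The weights may be replaced
by their positive parts because subsets of independent sets are independent.
If B_i is an independent set of maximum weight for g_i >= 0, then
f_i = g_i 1_(B_i) has total weight at most t_i, and its M_i-span dominates g_i: by
an exchange argument, v is spanned by those elements of B_i that weigh
at least g_i(v) ([span_fun_max_weight]). So (f_1, ..., f_k) is a cooperative
cover of value at most that of an optimal x.

Linear programming duality ([lp_strong_duality]), with both optima attained, is
derived from Farkas' lemma over an ordered field, which is proved by induction
on the number of inequalities. *)

(** * The standard bilinear form *)

Definition pairing (F : realFieldType) (K : finType) (a y : K -> F) : F :=
  \sum_k a k * y k.

Section Pairing.
Variables (F : realFieldType) (K : finType).
Implicit Types (a b x y z : K -> F).

Lemma pairingC a y : pairing a y = pairing y a.
Proof. by apply: eq_bigr => k _; rewrite mulrC. Qed.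

Lemma pairingBr a y z t :
  pairing a (fun k => y k - t * z k) = pairing a y - t * pairing a z.
Proof.
by rewrite /pairing mulr_sumr -sumrB; apply: eq_bigr => k _; ring.
Qed.

Lemma pairingBl a b t y :
  pairing (fun k => a k - t * b k) y = pairing a y - t * pairing b y.
Proof. by rewrite pairingC pairingBr !(pairingC y). Qed.

Lemma pairingNl a y : pairing (fun k => - a k) y = - pairing a y.
Proof. by rewrite /pairing -sumrN; apply: eq_bigr => k _; rewrite mulNr. Qed.

Lemma pairing0l y : pairing (fun=> 0) y = 0.
Proof. by rewrite /pairing big1 // => k _; rewrite mul0r. Qed.

Lemma pairing_deltal y t k0 :
  pairing (fun k => t * (k0 == k)%:R) y = t * y k0.
Proof.
rewrite /pairing (bigD1 k0) //= eqxx mulr1 big1 ?addr0 // => k kk0.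
by rewrite eq_sym (negbTE kk0) mulr0 mul0r.
Qed.

Lemma pairing_scaler x y t :
  pairing x (fun k => t * y k) = t * pairing x y.
Proof. by rewrite /pairing mulr_sumr; apply: eq_bigr => k _; ring. Qed.

Lemma le_pairing x y z :
  (forall k, 0 <= x k) -> (forall k, y k <= z k) -> pairing x y <= pairing x z.
Proof. by move=> x0 yz; apply: ler_sum => k _; exact: ler_wpM2l. Qed.

End Pairing.

Section FiniteSums.
Variable R : nmodType.

Lemma sum_unit (f : unit -> R) : \sum_u f u = f tt.
Proof. by rewrite (big_pred1 tt) // => -[]. Qed.

Lemma sum_fiber (X Y : finType) (x0 : X) (F : X * Y -> R) :
  (forall x y, x != x0 -> F (x, y) = 0) -> \sum_p F p = \sum_y F (x0, y).
Proof.
move=> F0; rewrite (eq_bigr (fun p => F (p.1, p.2))) => [|[]//].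
rewrite -(pair_bigA _ (fun x y => F (x, y))) (bigD1 x0) //=.
rewrite [X in _ + X]big1 ?addr0 // => x xx0.
by rewrite big1 // => y _; exact: F0.
Qed.

End FiniteSums.

(** * Farkas' lemma *)

Section Farkas.
Variables (F : realFieldType) (K : finType).
Implicit Types (a b g y z : K -> F).

(** Induction on m. If the first m of m + 1 inequalities do not already imply the
one for [g], some z satisfies them and violates it, so the last form is positive
at z. Projecting along z onto the hyperplane
where the last form vanishes turns the hypothesis into one about m
projected forms; undoing the projection costs a multiple of the last form,
whose coefficient is nonnegative because of the signs at z. *)
Lemma farkas_ord m (a : nat -> K -> F) g :
  (forall y, (forall j, (j < m)%N -> pairing (a j) y <= 0) -> pairing g y <= 0) ->
  exists2 c : nat -> F, (forall j, 0 <= c j) &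
    forall k, g k = \sum_(j < m) c j * a j k.
Proof.
elim: m a g => [|m IHm] a g hg.
  exists (fun=> 0) => // k; rewrite big_ord0.
  (* No inequality holds [g] back, so it can be evaluated at itself. *)
  have /hg : forall j, (j < 0)%N -> pairing (a j) g <= 0 by [].
  have sq_ge0 l : true -> 0 <= g l * g l by rewrite -expr2 sqr_ge0.
  rewrite le_eqVlt ltNge sumr_ge0 // orbF /pairing psumr_eq0 // => /allP/(_ k).
  by rewrite mem_index_enum mulf_eq0 orbb => /(_ isT)/eqP.
case: (pselect (exists2 y, forall j, (j < m)%N -> pairing (a j) y <= 0 &
    0 < pairing g y)) => [[z az gz]|no_z]; last first.
  have [|c c0 gE] := IHm a g.
    by move=> y ay; rewrite leNgt; apply/negP => gy; apply: no_z; exists y.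
  exists (fun j => if (j < m)%N then c j else 0) => [j|k]; first by case: ifP.
  rewrite big_ord_recr /= ltnn mul0r addr0 gE.
  by apply: eq_bigr => j _; rewrite ltn_ord.
have amz : 0 < pairing (a m) z.
  rewrite ltNge; apply/negP => amz; suff: pairing g z <= 0 by rewrite leNgt gz.
  by apply: hg => j; rewrite ltnS leq_eqVlt => /predU1P[->|/az].
pose t b := pairing b z / pairing (a m) z.
(* [slide b] is [b] composed with the projection along [z]. *)
pose slide b := fun k => b k - t b * a m k.
have slideE b y : pairing (slide b) y =
    pairing b (fun k => y k - (pairing (a m) y / pairing (a m) z) * z k).
  by rewrite pairingBl pairingBr /t; field; rewrite gt_eqF.
have [y ay|c c0 gE] := IHm (fun j => slide (a j)) (slide g).
  rewrite slideE; apply: hg => j; rewrite ltnS leq_eqVlt => /predU1P[->|jm].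
    by rewrite pairingBr divfK ?gt_eqF// subrr.
  by rewrite -slideE; exact: ay.
exists (fun j => if (j < m)%N then c j else t g - \sum_(i < m) c i * t (a i)).
  move=> j; case: ifP => // _; rewrite subr_ge0 (@le_trans _ _ 0) //.
    apply: sumr_le0 => i _; rewrite mulr_ge0_le0 // /t mulr_le0_ge0 ?az //.
    by rewrite invr_ge0 ltW.
  by rewrite /t divr_ge0 // ltW.
move=> k; rewrite big_ord_recr /= ltnn mulrBl mulr_suml addrCA -sumrB.
have := gE k; rewrite /slide => /eqP; rewrite subr_eq addrC => /eqP ->.
by congr (_ + _); apply: eq_bigr => j _; rewrite ltn_ord; ring.
Qed.

Lemma farkas (G : finType) (a : G -> K -> F) g :
  (forall y, (forall j, pairing (a j) y <= 0) -> pairing g y <= 0) ->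
  exists2 c : G -> F, (forall j, 0 <= c j) &
    forall k, g k = \sum_j c j * a j k.
Proof.
move=> hg; pose val i := nth (fun=> 0) [seq a j | j <- enum G] i.
have valE j : val (enum_rank j) = a j.
  by rewrite /val (nth_map j) -?cardE// nth_enum_rank.
have [y ay|c c0 gE] := @farkas_ord #|G| val g.
  by apply: hg => j; rewrite -valE; exact: ay.
exists (fun j => c (enum_rank j)) => // k.
rewrite gE (reindex (@enum_rank G)) /=; last first.
  exact/onW_bij/enum_rank_bij.
by apply: eq_bigr => j _; rewrite valE.
Qed.

(** An equality is a pair of opposite inequalities, so its multiplier, a
difference of two nonnegative ones, has arbitrary sign. *)
Lemma farkas_mixed (G H : finType) (a : G -> K -> F) (b : H -> K -> F) g :
  (forall y, (forall j, pairing (a j) y <= 0) ->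
     (forall h, pairing (b h) y = 0) -> pairing g y <= 0) ->
  exists (c : G -> F) (d : H -> F), (forall j, 0 <= c j) /\
    forall k, g k = \sum_j c j * a j k + \sum_h d h * b h k.
Proof.
move=> hg.
have [y aby|c c0 gE] := @farkas (G + (H + H))%type (fun j =>
    match j with
    | inl j => a j | inr (inl h) => b h | inr (inr h) => fun k => - b h k
    end) g.
  apply: hg => [j|h]; first exact: aby (inl j).
  apply/le_anti; rewrite (aby (inr (inl h))) /= -oppr_le0 -pairingNl.
  exact: aby (inr (inr h)).
exists (c \o inl), (fun h => c (inr (inl h)) - c (inr (inr h))).
split=> [j|k]; first exact: c0.
rewrite gE !big_sumType /= -big_split /=; congr (_ + _).
by apply: eq_bigr => h _; ring.
Qed.

End Farkas.

(** * Linear programming duality *)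

Section LinearProgramming.
Variables (F : realFieldType) (I J : finType).
Variables (A : I -> J -> F) (b : I -> F) (c : J -> F).

(** The coordinates of a linear system with one line for each primal equation, one
for each dual constraint, and one that compares the two objectives. *)
Definition block (u : I -> F) (v : J -> F) (t : F) (k : I + (J + unit)) : F :=
  match k with inl i => u i | inr (inl j) => v j | inr (inr _) => t end.

Lemma pairing_block u v t y : pairing (block u v t) y =
  pairing u (y \o inl) + (pairing v (y \o inr \o inl) + t * y (inr (inr tt))).
Proof.
rewrite /pairing !big_sumType /=; congr (_ + (_ + _)).
exact: sum_unit.
Qed.

Lemma pairing_swap (p : I -> F) (q : J -> F) :
  pairing q (fun j => pairing (A^~ j) p) = pairing p (fun i => pairing (A i) q).
Proof.
rewrite /pairing; under eq_bigr do rewrite mulr_sumr.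
rewrite exchange_big; apply: eq_bigr => i _; rewrite mulr_sumr.
by apply: eq_bigr => j _; ring.
Qed.

Lemma sum_mulr0 (K : finType) (y : K -> F) : \sum_k y k * 0 = 0.
Proof. by rewrite big1 // => k _; rewrite mulr0. Qed.

(** Optimality of a feasible pair is one more linear inequality, so a pair of
optimal solutions is a solution of a single linear system, and Farkas' lemma
applies to it. The variables of that system (the l and d found below) are x, the
slack of the dual constraints, the slack of [pairing b y <= pairing c x], and
the free variable y. A certificate of infeasibility is a triple (p, q, s) as
below. If s > 0, it contradicts weak duality between q / s and - p / s; if s = 0,
it contradicts the existence of feasible points. *)
Theorem lp_strong_duality :
  (exists2 x : J -> F, (forall j, 0 <= x j) & forall i, pairing (A i) x = b i) ->
  (exists y : I -> F, forall j, c j <= pairing (A^~ j) y) ->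
  exists (x : J -> F) (y : I -> F),
    [/\ forall j, 0 <= x j, forall i, pairing (A i) x = b i,
        forall j, c j <= pairing (A^~ j) y & pairing b y <= pairing c x].
Proof.
move=> [x0 x0_ge0 Ax0] [y0 Ay0].
have [y ineqs eqs|l [d [l_ge0 kE]]] := @farkas_mixed F (I + (J + unit))%type
    (J + (J + unit))%type I
    (fun g => match g with
     | inl j => block (A^~ j) (fun=> 0) (c j)
     | inr (inl j) => block (fun=> 0) (fun j' => -1 * (j == j')%:R) 0
     | inr (inr _) => block (fun=> 0) (fun=> 0) (-1)
     end)
    (fun i => block (fun=> 0) (A i) (- b i)) (block b c 0).
- rewrite pairing_block mul0r addr0.
  set p := y \o inl; set q := y \o inr \o inl.
  set s := y (inr (inr tt)) in eqs *.
  have {}eqs i : pairing (A i) q = s * b i.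
    have := eqs i; rewrite pairing_block pairing0l add0r mulNr.
    by move/eqP; rewrite subr_eq0 mulrC => /eqP.
  have q_ge0 j : 0 <= q j.
    have := ineqs (inr (inl j)).
    by rewrite pairing_block !pairing0l pairing_deltal -/q; lra.
  have s_ge0 : 0 <= s.
    by have := ineqs (inr (inr tt)); rewrite pairing_block !pairing0l -/s; lra.
  have prices j : s * c j <= - pairing (A^~ j) p.
    by have := ineqs (inl j); rewrite pairing_block pairing0l -/p -/s; lra.
  (* Weak duality for the homogenized programs. *)
  have Ap x : (forall j, 0 <= x j) ->
      s * pairing c x <= - pairing p (fun i => pairing (A i) x).
    move=> x_ge0; rewrite -pairing_swap (pairingC c) -pairing_scaler.
    rewrite -[leRHS]mulN1r -pairing_scaler; apply: le_pairing => // j.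
    by rewrite mulN1r; exact: prices.
  move: s_ge0; rewrite le_eqVlt => /predU1P[s0|s_gt0].
    have := Ap x0 x0_ge0; rewrite (funext Ax0) -s0 mul0r pairingC.
    have := @le_pairing _ _ q c _ q_ge0 Ay0; rewrite pairing_swap (pairingC q).
    under [X in pairing y0 X]eq_fun do rewrite eqs -s0 mul0r.
    by rewrite (pairingC y0) pairing0l; lra.
  rewrite -(pmulr_rle0 _ s_gt0).
  have := Ap q q_ge0; rewrite (funext eqs) pairing_scaler (pairingC p).
  by rewrite mulrDr; lra.
(* The three blocks of coordinates of [kE] are the three lines of the system. *)
- exists (l \o inl), d; split=> [j|i|j|]; first exact: l_ge0.
  + rewrite -[RHS]/(block b c 0 (inl i)) kE !big_sumType /= !sum_mulr0 !addr0.
    exact: pairingC.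
  + rewrite -[leLHS]/(block b c 0 (inr (inl j))) kE !big_sumType /= !sum_mulr0.
    rewrite (bigD1 j) //= eqxx big1 => [|j' /negbTE ->]; last by rewrite !mulr0.
    rewrite [X in _ + X](pairingC d) mulr1; have := l_ge0 (inr (inl j)); lra.
  + have := kE (inr (inr tt)); rewrite !big_sumType /= sum_mulr0.
    rewrite sum_unit [X in X + _ + _](pairingC _ c).
    rewrite [X in _ + X](pairingC d) pairingNl.
    by have := l_ge0 (inr (inr tt)); rewrite /comp; lra.
Qed.

End LinearProgramming.

(** * Rank and closure in matroids *)

Section MatroidFacts.
Variables (V : finType) (M : matroid V).
Implicit Types (A B I J S T : {set V}).

Lemma card_le_rank S A : S \in indep M -> S \subset A -> (#|S| <= rank M A)%N.
Proof. by move=> Si SA; apply: leq_bigmax_cond; rewrite Si. Qed.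

Lemma rank_basis A :
  exists2 B, B \in indep M & B \subset A /\ #|B| = rank M A.
Proof.
have [|B] := @eq_bigmax_cond _ [pred S | (S \in indep M) && (S \subset A)]
  (fun S => #|S|).
  by apply/card_gt0P; exists finset.set0; rewrite inE indep0 finset.sub0set.
by rewrite inE => /andP[Bi BA] rkE; exists B.
Qed.

Lemma rank_le_card A : (rank M A <= #|A|)%N.
Proof. by have [B _ [BA <-]] := rank_basis A; exact: subset_leq_card. Qed.

Lemma indep_extend I B : I \in indep M -> B \in indep M ->
  exists2 J, J \in indep M &
    [/\ I \subset J, J \subset I :|: B & (#|B| <= #|J|)%N].
Proof.
move=> Ii Bi; move: {2}(#|B| - #|I|)%N (leqnn (#|B| - #|I|)) => n.
elim: n I Ii => [|n IHn] I Ii; have [BI|IB] := leqP #|B| #|I|.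
- by move=> _; exists I => //; split=> //; exact: finset.subsetUl.
- by rewrite leqNgt subn_gt0 IB.
- by move=> _; exists I => //; split=> //; exact: finset.subsetUl.
have [x] := indep_aug Ii Bi IB; rewrite inE => /andP[xI xB] xIi Bn.
have [|J Ji [xIJ JxB BJ]] := IHn (x |: I) xIi.
  by rewrite cardsU1 xI; lia.
exists J => //; split=> //.
  exact: fintype.subset_trans (finset.subsetU1 x I) xIJ.
apply: fintype.subset_trans JxB _.
rewrite -finset.setUA finset.subUset subxx andbT.
by rewrite finset.sub1set inE xB orbT.
Qed.

Lemma mem_span_indep v T :
  T \in indep M -> v \notin span M T -> v |: T \in indep M.
Proof.
move=> Ti; have [C Ci [CvT rkC]] := rank_basis (v |: T).
rewrite inE eqn_leq negb_and -!ltnNge => rk_neq.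
suff -> : v |: T = C by [].
apply/esym/eqP; rewrite eqEcard CvT rkC cardsU1.
have := card_le_rank Ti (subxx T); have := card_le_rank Ti (finset.subsetU1 v T).
have := rank_le_card T; move: rk_neq; case: (v \notin T); lia.
Qed.

(** If x is spanned by T but not by a superset A of T, extend a basis of T to a set
J as large as a basis of [x |: A]. As J is too large to lie in A, it contains x, so
x can be added to the basis of T. *)
Lemma span_mono T A : T \subset A -> span M T \subset span M A.
Proof.
move=> TA; apply/fintype.subsetP => x xT; apply/negPn/negP => xA.
have [C Ci [CxA rkC]] := rank_basis (x |: A).
have [I Ii [IT rkI]] := rank_basis T.
have [J Ji [IJ JIC CJ]] := indep_extend Ii Ci.
have rk_lt : (rank M A < rank M (x |: A))%N.
  move: xA; rewrite inE eq_sym ltn_neqAle => -> /=.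
  have [B Bi [BA <-]] := rank_basis A; apply: card_le_rank => //.
  exact: fintype.subset_trans BA (finset.subsetU1 x A).
have JxA : J \subset x |: A.
  apply: fintype.subset_trans JIC _; rewrite finset.subUset CxA andbT.
  exact: fintype.subset_trans (fintype.subset_trans IT TA) (finset.subsetU1 x A).
have NJA : ~~ (J \subset A).
  by apply/negP => /(card_le_rank Ji); rewrite leqNgt (leq_trans rk_lt) // -rkC.
have [xJ NxA] : x \in J /\ x \notin A.
  case/fintype.subsetPn: NJA => y yJ yA; move: (fintype.subsetP JxA y yJ).
  by rewrite !inE (negbTE yA) orbF => /eqP <-.
have xIi : x |: I \in indep M.
  by apply: indep_sub Ji; rewrite finset.subUset finset.sub1set xJ.
move: xT; rewrite inE => /eqP rkT.
have := card_le_rank xIi (finset.setUS [set x]%SET IT).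
rewrite rkT -rkI cardsU1 (contra _ NxA) ?ltnn //.
by move=> xI; apply: (fintype.subsetP TA); exact: (fintype.subsetP IT).
Qed.

Lemma indep_le_span S A :
  S \in indep M -> S \subset span M A -> (#|S| <= rank M A)%N.
Proof.
move=> Si SA; rewrite leqNgt; apply/negP.
have [B Bi [BA rkB]] := rank_basis A; rewrite -rkB => BS.
have [x] := indep_aug Bi Si BS; rewrite inE => /andP[xB xS] xBi.
have := fintype.subsetP SA x xS; rewrite inE => /eqP rkE.
have := card_le_rank xBi (finset.setUS [set x]%SET BA).
by rewrite rkE -rkB cardsU1 xB ltnn.
Qed.

End MatroidFacts.

(** * The span of a function and independent sets *)

Section Weights.
Variables (R : realType) (V : finType) (M : matroid V).
Hypothesis M_loopless : loopless M.
Implicit Types (f g : V -> R) (S T : {set V}).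

(** Induction on S: remove an element v of S at which the span of [f] takes its
least value c over S. All of S lies in the span of {f >= c}, which therefore has
at least #|S| elements; one of them is outside the set obtained for S minus v and
can be matched with v. *)
Lemma sum_span_fun_le f S : S \in indep M ->
  exists2 U : {set V}, #|U| = #|S| &
    \sum_(v in S) span_fun M f v <= \sum_(u in U) f u.
Proof.
move: {2}#|S| (erefl #|S|) => n; elim: n S => [|n IHn] S cardS Si.
  exists S => //; move/eqP: cardS; rewrite cards_eq0 => /eqP ->.
  by rewrite !big_set0.
have [v0 v0S] : exists v, v \in S by apply/card_gt0P; rewrite cardS.
case: (@arg_minP _ _ _ v0 [in S] (span_fun M f) v0S) => v /= vS v_min {v0 v0S}.
have [||U cardU sumU] := IHn (S :\ v).
- by move: cardS; rewrite (cardsD1 v) vS => -[].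
- exact: indep_sub (finset.subsetDl _ _) Si.
pose A := [set u | span_fun M f v <= f u]%SET.
have SA : S \subset span M A.
  apply/fintype.subsetP => x xS.
  have [[T [T0 xT fxE]] _] := span_funP f x M_loopless.
  apply: fintype.subsetP xT; apply: span_mono; apply/fintype.subsetP => u uT.
  rewrite inE (le_trans (v_min x xS)) // fxE.
  by have [_] := min_onP f T0; apply.
have [u] : exists u, u \in A :\: U.
  apply/card_gt0P; rewrite cardsD subn_gt0.
  rewrite (leq_ltn_trans (subset_leq_card (finset.subsetIr _ _))) // cardU.
  apply: leq_trans (leq_trans (indep_le_span Si SA) (rank_le_card M A)).
  by rewrite (cardsD1 v S) vS.
rewrite !inE => /andP[uU uA]; exists (u |: U).
  by rewrite cardsU1 uU cardU (cardsD1 v S) vS.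
by rewrite (big_setD1 v) //= big_setU1 //= lerD.
Qed.

Lemma dot_span_fun_le f (x : V -> R) : nonneg_fun f -> matroid_polytope M x ->
  dot x (span_fun M f) <= total f.
Proof.
move=> f0 [a [a0 a1 xE]]; rewrite /dot.
under eq_bigr do rewrite xE mulr_suml.
rewrite exchange_big /= -[leRHS]mul1r -a1 mulr_suml; apply: ler_sum => S Si.
under eq_bigr do rewrite -mulrA.
rewrite -mulr_sumr ler_wpM2l ?a0 //.
have [U _] := sum_span_fun_le f Si.
rewrite [in leLHS]big_mkcond /= => le_U.
apply: le_trans (_ : \sum_(u in U) f u <= _).
  apply: le_trans le_U; apply: ler_sum => v _; rewrite /indicator.
  by case: (v \in S); rewrite ?mul1r ?mul0r.
by rewrite /total [leRHS](bigID (mem U)) /= lerDl sumr_ge0.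
Qed.

(** For v outside B, let T be the set of elements of B that weigh at least as much
as v. If T spans v, it bounds the span from below by g(v). Otherwise [v |: T] can
be extended inside [v |: B] to an independent set of size at least #|B|. It gains
v and loses at most one element of B, which lies outside T and is thus lighter
than v. By the maximality of B, nothing is lost and g(v) = 0. *)
Lemma span_fun_max_weight g B v : nonneg_fun g -> B \in indep M ->
  (forall S, S \in indep M -> \sum_(u in S) g u <= \sum_(u in B) g u) ->
  g v <= span_fun M (fun u => g u * indicator R B u) v.
Proof.
move=> g0 Bi B_max; set f := fun u => _.
have [_ f_ge] := span_funP f v M_loopless.
have f_ge1 : f v <= span_fun M f v.
  by rewrite -(min_on_set1 f v); have [] := f_ge [set v]%SET (span_set1 M v).
have [vB|vB] := boolP (v \in B).
  by rewrite (le_trans _ f_ge1) // /f /indicator vB mulr1.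
pose T := [set u in B | g v <= g u]%SET.
have TB : T \subset B by apply/fintype.subsetP => u; rewrite inE => /andP[].
have [vT|vT] := boolP (v \in span M T).
  have [T0] := f_ge T vT; have [[u uT ->] _] := min_onP f T0; apply: le_trans.
  by move: uT; rewrite inE /f /indicator => /andP[->]; rewrite mulr1.
have vTi := mem_span_indep (indep_sub TB Bi) vT.
have [J Ji [vTJ JvB BJ]] := indep_extend vTi Bi.
have vJ : v \in J by apply: (fintype.subsetP vTJ); rewrite finset.setU11.
have JB : J :\ v = B :&: J.
  apply/setP => u; rewrite !inE; have [->|uv] := eqVneq u v.
    by rewrite (negbTE vB).
  apply/idP/andP => [uJ|[]//]; split=> //.
  have := fintype.subsetP JvB u uJ; rewrite !inE (negbTE uv) /=.
  by case/orP => // /andP[].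
have BDJ : (#|B :\: J| <= 1)%N.
  move: BJ; rewrite (cardsD1 v J) vJ JB -(cardsID J B) addnC.
  by rewrite leq_add2r.
have := B_max J Ji.
rewrite (big_setD1 v) //= JB [leRHS](big_setID J) /= addrC lerD2l.
(* The weight of v is now bounded by that of the part of B lost in J. *)
have [BJ0|[u uBJ]] := set_0Vmem (B :\: J).
  rewrite BJ0 big_set0 => gv0; apply: le_trans gv0 (le_trans _ f_ge1).
  by rewrite mulr_ge0 // /indicator ler0n.
have -> : B :\: J = [set u]%SET.
  by apply/esym/eqP; rewrite eqEcard finset.sub1set uBJ cards1.
rewrite big_set1 => gvu; move: uBJ; rewrite inE => /andP[/negP uJ uB]; case: uJ.
by apply: (fintype.subsetP vTJ); rewrite !inE uB gvu orbT.
Qed.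

Lemma matroid_polytope_ge0 (x : V -> R) :
  matroid_polytope M x -> nonneg_fun x.
Proof.
move=> [a [a0 _ xE]] v; rewrite xE; apply: sumr_ge0 => S Si.
by rewrite mulr_ge0 ?a0 // /indicator ler0n.
Qed.

Lemma exists_max_weight (g : V -> R) :
  exists2 B, B \in indep M &
    forall S, S \in indep M -> \sum_(u in S) g u <= \sum_(u in B) g u.
Proof.
case: (@arg_maxP _ _ _ _ [in indep M] (fun S : {set V} => \sum_(u in S) g u)
  (indep0 M)) => B /= Bi B_max.
by exists B.
Qed.

(** Dropping the elements of nonpositive weight from an independent set leaves an
independent set, so the bound for [g] also bounds the sums of positive parts. *)
Lemma sum_positive_part_le g (t : R) :
  (forall S, S \in indep M -> \sum_(u in S) g u <= t) ->
  forall S, S \in indep M -> \sum_(u in S) Num.max 0 (g u) <= t.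
Proof.
move=> g_le S Si; pose P := [set u in S | 0 < g u]%SET.
have PS : P \subset S by apply/fintype.subsetP => u; rewrite inE => /andP[].
apply: le_trans (g_le P (indep_sub PS Si)).
rewrite (big_setID P) /= (finset.setIidPr PS) [X in _ + X]big1 ?addr0.
  by apply: ler_sum => u; rewrite inE => /andP[_ gu]; rewrite max_r // ltW.
by move=> u; rewrite !inE => /andP[]; case: (u \in S) => // /=; case: ltP.
Qed.

End Weights.

(** * Duality between matchings and cooperative covers *)

Section Duality.
Variables (R : realType) (V : finType) (k : nat) (L : 'I_k -> matroid V).
Variable w : V -> R.
Hypothesis L_loopless : forall i, loopless (L i).

Lemma weak_duality (x : V -> R) (f : 'I_k -> V -> R) :
  (forall v, 0 <= x v) -> common_polytope L x -> cooperative_cover L w f ->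
  dot x w <= \sum_i total (f i).
Proof.
move=> x0 Lx [f0 cover].
apply: (@le_trans _ _ (\sum_i dot x (span_fun (L i) (f i)))).
  rewrite /dot exchange_big /=; apply: ler_sum => v _.
  by rewrite -mulr_sumr ler_wpM2l.
by apply: ler_sum => i _; exact: dot_span_fun_le.
Qed.

(** The cover consists of the positive parts of the [g i], each restricted to an
independent set of maximum weight. *)
Lemma cover_of_weights (g : 'I_k -> V -> R) (t : 'I_k -> R) :
  (forall v, w v <= \sum_i g i v) ->
  (forall i S, S \in indep (L i) -> \sum_(u in S) g i u <= t i) ->
  exists2 f, cooperative_cover L w f & \sum_i total (f i) <= \sum_i t i.
Proof.
move=> w_le g_le; pose h i v : R := Num.max 0 (g i v).
have h0 i : nonneg_fun (h i) by move=> v; rewrite le_max lexx.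
have [B] := fin_all_exists2 (fun i => exists_max_weight (L i) (h i)).
move=> Bi B_max; exists (fun i u => h i u * indicator R (B i) u).
  split=> [i v|v]; first by rewrite mulr_ge0 ?h0 // ler0n.
  apply: le_trans (w_le v) _; apply: ler_sum => i _.
  apply: le_trans (_ : h i v <= _); first by rewrite le_max lexx orbT.
  exact: (span_fun_max_weight (L_loopless i) v (h0 i) (Bi i) (B_max i)).
apply: ler_sum => i _; apply: le_trans (sum_positive_part_le (g_le i) (Bi i)).
rewrite /total [leRHS]big_mkcond /=; apply: ler_sum => u _.
by rewrite /indicator; case: (u \in B i); rewrite ?mulr1 ?mulr0.
Qed.

Let Row := ('I_k * V + 'I_k)%type.
Let Col := (V + 'I_k * {set V})%type.

(** The matching problem as a linear program: maximize [hull_cost] subject to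
[hull_matrix] times the variables being [hull_rhs]. The column [inl v] is the
variable x(v), and the column [inr (i, S)] is the coefficient of 1_S in the
representation of x as a convex combination for the i-th matroid. The row
[inl (i, v)] says that this combination has value x(v) at v, and the row [inr i]
that its coefficients add up to 1. The columns of dependent sets vanish,
which makes the column type independent of the matroids. *)
Definition hull_matrix (r : Row) (c : Col) : R :=
  match r, c with
  | inl (i, v), inl u => - (v == u)%:R
  | inl (i, v), inr (j, T) => [&& i == j, T \in indep (L j) & v \in T]%:R
  | inr i, inl _ => 0
  | inr i, inr (j, T) => ((i == j) && (T \in indep (L j)))%:R
  end.

Definition hull_rhs (r : Row) : R := if r is inr _ then 1 else 0.

Definition hull_cost (c : Col) : R := if c is inl v then w v else 0.

Lemma pairing_hull_matrix_inl i v x : pairing (hull_matrix (inl (i, v))) x =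
  \sum_(S in indep (L i)) x (inr (i, S)) * indicator R S v - x (inl v).
Proof.
rewrite /pairing big_sumType /= addrC; congr (_ + _).
  rewrite (sum_fiber (x0 := i)) => [|j S /negbTE ji]; last first.
    by rewrite eq_sym ji mul0r.
  rewrite [RHS]big_mkcond; apply: eq_bigr => S _; rewrite eqxx /= mulrC.
  by case: (S \in _); rewrite ?mulr0.
rewrite (bigD1 v) //= eqxx mulN1r [X in _ + X]big1 ?addr0 // => u /negbTE uv.
by rewrite eq_sym uv oppr0 mul0r.
Qed.

Lemma pairing_hull_matrix_inr i x : pairing (hull_matrix (inr i)) x =
  \sum_(S in indep (L i)) x (inr (i, S)).
Proof.
rewrite /pairing big_sumType /= big1 ?add0r => [|v _]; last by rewrite mul0r.
rewrite (sum_fiber (x0 := i)) => [|j S /negbTE ji]; last first.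
  by rewrite eq_sym ji mul0r.
rewrite [RHS]big_mkcond; apply: eq_bigr => S _; rewrite eqxx /=.
by case: (S \in _); rewrite ?mul0r ?mul1r.
Qed.

Lemma pairing_hull_matrix_coinl v y :
  pairing (hull_matrix^~ (inl v)) y = - \sum_i y (inl (i, v)).
Proof.
rewrite /pairing big_sumType /= [X in _ + X]big1 ?addr0; last first.
  by move=> i _; rewrite mul0r.
rewrite -sumrN.
rewrite (eq_bigr (fun p => - (p.2 == v)%:R * y (inl (p.1, p.2)))) => [|[]//].
rewrite -(pair_bigA _ (fun i u => - (u == v)%:R * y (inl (i, u)))) /=.
apply: eq_bigr => i _; rewrite (bigD1 v) //= eqxx mulN1r.
rewrite [X in _ + X]big1 ?addr0 // => u /negbTE ->.
by rewrite oppr0 mul0r.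
Qed.

Lemma pairing_hull_matrix_coinr i S y : S \in indep (L i) ->
  pairing (hull_matrix^~ (inr (i, S))) y =
  y (inr i) + \sum_(v in S) y (inl (i, v)).
Proof.
move=> Si; rewrite /pairing big_sumType /= addrC; congr (_ + _).
  rewrite (bigD1 i) //= eqxx Si mul1r [X in _ + X]big1 ?addr0 // => j /negbTE ->.
  by rewrite mul0r.
rewrite (sum_fiber (x0 := i)) => [|j v /negbTE ->]; last by rewrite mul0r.
rewrite [RHS]big_mkcond; apply: eq_bigr => v _; rewrite eqxx Si /=.
by case: (v \in S); rewrite ?mul0r ?mul1r.
Qed.

Lemma strong_duality : (1 <= k)%N -> nonneg_fun w ->
  exists x f, [/\ common_polytope L x, cooperative_cover L w f &
    \sum_i total (f i) <= dot x w].
Proof.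
move=> k_ge1 w0.
have [||x [y [x0 xE y_ge y_le]]] :=
    @lp_strong_duality R Row Col hull_matrix hull_rhs hull_cost.
(* Primal feasible point: x = 0, as the combination of the empty set alone. *)
- exists (fun c => if c is inr (_, T) then (T == finset.set0)%:R else 0).
    by case=> // -[i S]; exact: ler0n.
  case=> [[i v]|i].
    rewrite pairing_hull_matrix_inl subr0 big1 // => S _.
    by have [->|] := eqVneq; rewrite ?mul0r // /indicator inE mulr0.
  rewrite pairing_hull_matrix_inr (bigD1 finset.set0) ?indep0 //= eqxx.
  by rewrite big1 ?addr0 // => S /andP[_ /negbTE ->].
(* Dual feasible point: all weights equal to [w], of sum k * w >= w. *)
- exists (fun r => match r with inl (_, v) => - w v | inr _ => \sum_v w v end).
  case=> [v|[i S]].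
    rewrite pairing_hull_matrix_coinl sumrN opprK sumr_const card_ord /=.
    by rewrite -mulr_natr ler_peMr // ler1n.
  have [Si|Si] := boolP (S \in indep (L i)).
    rewrite pairing_hull_matrix_coinr //= sumrN subr_ge0.
    by rewrite [leRHS](bigID (mem S)) /= lerDl sumr_ge0.
  rewrite /pairing big1 // => -[[j v]|j] _ /=;
    by rewrite (negbTE Si) ?andbF mul0r.
have xP i v : x (inl v) =
    \sum_(S in indep (L i)) x (inr (i, S)) * indicator R S v.
  by have := xE (inl (i, v)); rewrite pairing_hull_matrix_inl => /eqP;
    rewrite subr_eq0 => /eqP.
(* In the equation of row [inl (i, v)], x(v) has coefficient -1, so the weights
   are the opposites of the dual variables. *)
have [|| f f_cover f_le] :=
    @cover_of_weights (fun i v => - y (inl (i, v))) (fun i => y (inr i)).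
- by move=> v; have := y_ge (inl v); rewrite pairing_hull_matrix_coinl sumrN.
- move=> i S Si; have := y_ge (inr (i, S)).
  by rewrite pairing_hull_matrix_coinr //= sumrN => ?; lra.
exists (x \o inl), f; split=> //.
  move=> i; exists (fun S => x (inr (i, S))).
  split=> [S _|//|v]; first exact: x0.
    by have := xE (inr i); rewrite pairing_hull_matrix_inr.
  exact: xP.
apply: le_trans f_le _; move: y_le; rewrite /pairing !big_sumType /=.
rewrite [X in X + _ <= _]big1 => [|r _]; last by rewrite mul0r.
rewrite [X in _ <= _ + X]big1 => [|r _]; last by rewrite mul0r.
rewrite add0r addr0; under eq_bigr do rewrite mul1r.
by under [leRHS]eq_bigr do rewrite mulrC.
Qed.

End Duality.

Lemma sup_maximum (R : realType) (A : set R) m : is_maximum A m -> sup A = m.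
Proof.
move=> [Am A_le]; apply/le_anti/andP; split.
  by apply: ge_sup => //; exists m.
by apply: ub_le_sup => //; exists m.
Qed.

Lemma inf_minimum (R : realType) (A : set R) m : is_minimum A m -> inf A = m.
Proof.
move=> [Am A_ge]; apply/le_anti/andP; split; last first.
  by apply: lb_le_inf => //; exists m.
by apply: ge_inf => //; exists m.
Qed.

Theorem theorem10p4 (R : realType) (V : finType) (k : nat)
    (L : 'I_k -> matroid V) (w : V -> R) (k_ge1 : (1 <= k)%N)
    (L_loopless : forall i, loopless (L i)) (w_ge0 : nonneg_fun w) :
  [/\ is_maximum (matching_values L w) (matching_number L w),
      is_minimum (covering_values L w) (covering_number L w) &
      covering_number L w = matching_number L w].
Proof.
have [x [f [Lx f_cover f_le]]] := strong_duality L_loopless k_ge1 w_ge0.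
have weak z h : common_polytope L z -> cooperative_cover L w h ->
    dot z w <= \sum_i total (h i).
  move=> Lz; apply: weak_duality => // v.
  exact: (matroid_polytope_ge0 (Lz (Ordinal k_ge1))).
have opt : \sum_i total (f i) = dot x w by apply/le_anti; rewrite f_le weak.
have max_x : is_maximum (matching_values L w) (dot x w).
  by split; [exists x|move=> _ [z Lz <-]; rewrite -opt; exact: weak].
have min_f : is_minimum (covering_values L w) (dot x w).
  by split; [exists f|move=> _ [h h_cover <-]; exact: weak].
rewrite /covering_number /matching_number.
by rewrite (sup_maximum max_x) (inf_minimum min_f).
Qed.
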